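(* Every compact group of Ulam-measurable weight admits a strictly finer countably compact group topology.
   Context: Topological groups are assumed Hausdorff. The weight of a space is the least cardinality of a base for it. An ultrafilter is $\omega_1$-complete if it is closed under intersections of countable families. A cardinal $\mathrm{Card}(A)$ is Ulam-measurable if there exists an $\omega_1$-complete free (nonprincipal) ultrafilter on $A$. A space is countably compact if every countable open cover has a finite subcover. *)

(* Defs.v *)
From HB Require Import structures.
From mathcomp Require Import all_boot all_classical topology.

Set Implicit Arguments.
Unset Strict Implicit.
Unset Printing Implicit Defensive.

Local Open Scope classical_set_scope.
Local Open Scope card_scope.

(* The set A represents the cardinal Card(A): the weight of T is Card(A). *)
Definition is_weight (T : topologicalType) (U : Type) (A : set U) : Prop :=
  (exists2 B : set (set T), basis B & B #= A) /\
  (forall B : set (set T), basis B -> A #<= B).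

Definition omega1_complete (T : Type) (F : set_system T) : Prop :=
  forall A : nat -> set T, (forall n, F (A n)) -> F (\bigcap_n A n).

(* The ultrafilter lives on the subtype of elements of A. *)
Definition ulam_measurable (U : Type) (A : set U) : Prop :=
  exists F : set_system A,
    [/\ UltraFilter F, omega1_complete F & forall x : A, F <> principal_filter x].

Definition countably_compact (T : topologicalType) (A : set T) : Prop :=
  forall (I : choiceType) (D : set I) (f : I -> set T), countable D ->
    (forall i, D i -> open (f i)) -> A `<=` cover D f -> finite_subset_cover D f A.

(* A topology on G is kept apart from the group structure, so that several
   topologies can be put on the same group. The Topological class also carries
   a choice structure, which plays no role here. *)
Definition topology_on (G : Type) : Type := Topological.axioms_ G.

Definition topologized (G : Type) (tau : topology_on G) : topologicalType :=
  Topological.Pack tau.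

Definition group_topology (G : groupType) (tau : topology_on G) : Prop :=
  let T := topologized tau in
  [/\ continuous ((fun xy => (xy.1 * xy.2)%g) : T * T -> T),
      continuous ((fun x => x^-1%g) : T -> T)
    & hausdorff_space T].

Definition strictly_finer (G : Type) (sigma tau : topology_on G) : Prop :=
  (@open (topologized tau) : set (set G)) `<`
  (@open (topologized sigma) : set (set G)).

(* Main.v *)
Require Import Defs.
From HB Require Import structures.
From mathcomp Require Import all_boot all_classical topology.

Set Implicit Arguments.
Unset Strict Implicit.
Unset Printing Implicit Defensive.

Local Open Scope classical_set_scope.

(** Let p be a free countably complete ultrafilter on an index set K. For a
family V of neighbourhoods of 1 in G indexed by K, let W_V be the set of those
x that lie in V a for p-almost every a. The sets W_V are the neighbourhoods of
1 in a group topology sigma, since the axioms can be checked index by index,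
and sigma is finer than tau, as constant families show. In other words sigma
is pulled back along the diagonal from the ultrapower of G.

Countable compactness comes from the completeness of p
([ultra_countably_compact]). For a sequence x of points of G let l be a cluster
point for tau. Given V, countably many statements [l^-1 * x n \in W_V] have to
be decided, so a single index a decides them all: there is an a such that, for
every n, [l^-1 * x n] is in W_V exactly when it is in V a. Hence l is also a
cluster point for sigma.

The weight enters only in showing that sigma differs from tau, for a suitable
choice of p. Well-order K, and call b small when no free countably complete
ultrafilter contains the initial segment below b. The ultrafilter p can be
chosen to concentrate on small indices ([ulam_minimal]). By recursion on b
choose a sequence V b of closed neighbourhoods of 1 shrinking fast enough that
its intersection, core (V b), is a closed subgroup, and such that V b 0 does
not contain the intersection L_b of the earlier cores. This is possible for
small b ([independent_towers]): if L_b were trivial, finite intersections of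
the earlier neighbourhoods would form a local base at 1, and their translates
a base of G indexed by finite sequences of elements below b and integers. As K
represents the weight of G, it would inject into this index set, and p would
be carried to a free countably complete ultrafilter below b.

Suppose now that the p-almost everywhere intersection W of the V a 4 contains
a tau-neighbourhood U of 1. By compactness, the product of U with the
intersection of all small cores already contains the intersection of finitely
many of them, so some level of V contains p-almost everywhere each point of
this finite intersection ([limit_not_nbhs]). On the other hand independence
gives a point of the finite intersection that avoids the V c for any given
finite set of larger small indices c ([avoid_finite]), hence by compactness a
point that avoids them for all larger small c, that is, for p-almost every
c. *)

(** * Countably complete ultrafilters *)

Definition ulam_ultrafilter (T : Type) (F : set_system T) : Prop :=
  [/\ UltraFilter F, omega1_complete F & forall x, ~ F [set x]].

Lemma ultra_image_filter (T Y : Type) (f : T -> Y) (F : set_system T) :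
  UltraFilter F -> UltraFilter (fun A : set Y => F (f @^-1` A)).
Proof.
move=> UF; pose FY : set_system Y := fun A => F (f @^-1` A).
have PF : ProperFilter FY.
  split; first by move=> F0; exact: (@filter_not_empty _ F).
  split; first exact: (@filterT _ F).
    by move=> A B FA FB; apply: (@filterI _ F).
  by move=> A B AB; apply: (@filterS _ F) => x; exact: AB.
split=> // H PH FH; apply/seteqP; split=> // A HA.
have [//|FnA] := @in_ultra_setVsetC _ F (f @^-1` A) UF.
have HnA : H (~` A) by apply: FH.
exfalso; apply: (@filter_not_empty _ H); rewrite -(setICr A); exact: filterI.
Qed.

(** Intersected over countably many sets A, this yields one point t that gives
the same answer as F to all of them. *)
Lemma ultra_decide (T : Type) (F : set_system T) (A : set T) :
  UltraFilter F -> F [set t | A t <-> F A].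
Proof.
move=> UF; have [FA|FnA] := @in_ultra_setVsetC _ F A UF.
  by apply: filterS (FA) => t At; split.
apply: filterS (FnA) => t nAt; split=> // FA.
exfalso; apply: (@filter_not_empty _ F); rewrite -(setICr A); exact: filterI.
Qed.

Lemma ulam_nat (F : set_system nat) : ~ ulam_ultrafilter F.
Proof.
move=> [UF cF nF]; have /cF : forall n, F (~` [set n]).
  by move=> n; have [/nF//|] := @in_ultra_setVsetC _ F [set n] UF.
move=> FA; apply: (@filter_not_empty _ F); apply: filterS FA => n /(_ n I).
exact.
Qed.

Lemma image_not_ulam (T Y : Type) (f : T -> Y) (F : set_system T) :
  ulam_ultrafilter F -> ~ ulam_ultrafilter (fun A : set Y => F (f @^-1` A)) ->
  exists y, F (f @^-1` [set y]).
Proof.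
move=> [UF cF nF] nfF; apply: contrapT => /forallNP ne; apply: nfF.
split=> //; first exact: ultra_image_filter.
by move=> A FA; apply: (cF (fun n => f @^-1` A n)).
Qed.

(** If every image of F under the maps f i were principal, each f i and each
g i would be constant on a set of F, hence all of them at once by countable
completeness; joint injectivity would make that set a point. This lets a free
countably complete ultrafilter on a set of finite sequences be pushed down to
one of the coordinates, and so replaces cardinal arithmetic. *)
Lemma ulam_joint_injective (T Y : Type) (f : nat -> T -> Y) (g : nat -> T -> nat)
    (F : set_system T) :
  (forall s t, (forall i, f i s = f i t) -> (forall i, g i s = g i t) -> s = t) ->
  ulam_ultrafilter F ->
  exists i, ulam_ultrafilter (fun A : set Y => F (f i @^-1` A)).
Proof.
move=> fg_inj uF; apply: contrapT => /forallNP nf.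
have /choice[y Fy] i := image_not_ulam uF (nf i).
have /choice[z Fz] i := image_not_ulam uF (@ulam_nat (fun A => F (g i @^-1` A))).
have [UF cF nF] := uF.
have FA : F (\bigcap_i f i @^-1` [set y i] `&` \bigcap_i g i @^-1` [set z i]).
  by apply: filterI; apply: cF.
have [t [fty gtz]] := filter_ex FA.
apply: (nF t); apply: filterS FA => s [fsy gsz]; apply: fg_inj => i.
  by rewrite (fsy i I) (fty i I).
by rewrite (gsz i I) (gtz i I).
Qed.

(** * Well-founded choices *)

Lemma strict_well_order (K : eqType) : exists lt : rel K,
  [/\ well_founded lt, transitive lt & forall a b, [\/ lt a b, a = b | lt b a]].
Proof.
have [R wR] := wochoice.well_ordering_principle K.
have Rmin (A : set K) : A !=set0 -> exists2 z, A z & forall x, A x -> R z x.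
  move=> [a Aa]; have [|z [[zA zmin] _]] := wR (mem A).
    by exists a; rewrite inE.
  by exists z => [|x Ax]; [rewrite inE in zA|apply: zmin; rewrite inE].
have Ranti a b : R a b -> R b a -> a = b.
  move=> Rab Rba; have [|z [_ zuniq]] := wR (pred2 a b).
    by exists a; rewrite inE eqxx.
  have refl x : R x x by have [|_ -> ] := Rmin [set x]; [exists x|exact].
  have <- : z = a by apply: zuniq; split; [rewrite !inE eqxx|move=> x /pred2P[]->].
  by apply: zuniq; split; [rewrite !inE eqxx orbT|move=> x /pred2P[]->].
have Rtot a b : R a b \/ R b a.
  have [|z] := Rmin [set a; b]; first by exists a; left.
  by case=> -> zmin; [left; apply: zmin; right|right; apply: zmin; left].
pose lt : rel K := fun a b => R a b && (a != b).
have tri a b : [\/ lt a b, a = b | lt b a].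
  have [<-|ne] := eqVneq a b; first by constructor 2.
  have [h|h] := Rtot a b; first by constructor 1; rewrite /lt h.
  by constructor 3; rewrite /lt h eq_sym.
have wf : well_founded lt.
  move=> a; apply: contrapT => na.
  have [|z nz zmin] := Rmin [set x | ~ Acc lt x]; first by exists a.
  apply: nz; split=> y /andP[Ryz yz]; apply: contrapT => /zmin Rzy.
  by move/eqP: yz; apply; exact: Ranti.
exists lt; split=> // b a c ab bc; have [//|ac|ca] := tri a c.
  by move: ab bc; rewrite -ac /lt => /andP[Rab /eqP ne] /andP[Rba _]; case: ne; apply: Ranti.
have [|z zA zmin] := Rmin [set a; b; c]; first by exists a; do 2!left.
have kill x y : [set a; b; c] x -> z = y -> lt x y -> False.
  move=> /zmin Rzx zy; rewrite -zy /lt => /andP[Rxz /eqP]; apply; exact: Ranti.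
exfalso; case: zA => [[za|zb]|zc].
- by apply: (kill c a) => //; right.
- by apply: (kill a b) => //; do 2!left.
- by apply: (kill b c) => //; left; right.
Qed.

(** Locality of P in its second argument makes up for the fact that, at stage b,
only the values of f below b have been chosen; the others are filled in with
x0. *)
Lemma well_founded_choice (K X : Type) (x0 : X) (lt : K -> K -> Prop)
    (P : K -> (K -> X) -> X -> Prop) : well_founded lt ->
  (forall b f g x, (forall c, lt c b -> f c = g c) -> P b f x -> P b g x) ->
  (forall b f, exists x, P b f x) -> exists f, forall b, P b f (f b).
Proof.
move=> wf Ploc exP; have /choice[h hP] : forall bf, exists x, P bf.1 bf.2 x.
  by move=> [b f]; exact: exP.
pose restr b (rec : forall c, lt c b -> X) c :=
  if pselect (lt c b) is left cb then rec c cb else x0.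
pose f := Fix wf (fun=> X) (fun b rec => h (b, restr b rec)).
have fE b : f b = h (b, restr b (fun c _ => f c)).
  rewrite /f Fix_eq // => {}b g g' gg'; congr (h (b, _)).
  by apply/funext => c; rewrite /restr; case: pselect.
exists f => b; rewrite fE; apply: Ploc (hP (b, _)) => c cb.
by rewrite /= /restr; case: pselect.
Qed.

Lemma seq_max (K : eqType) (lt : rel K) (c : K) (s : seq K) :
  transitive lt -> (forall a b, [\/ lt a b, a = b | lt b a]) ->
  exists2 m, m \in c :: s & forall a, a \in c :: s -> a != m -> lt a m.
Proof.
move=> ltT tri; elim: s c => [|d s IHs] c.
  by exists c => [|a]; rewrite ?inE // => ->.
have [m ms mmax] := IHs d; have [cm|cm|mc] := tri c m.
- exists m => [|a]; first by rewrite inE ms orbT.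
  by rewrite inE => /predU1P[->//|]; exact: mmax.
- exists m => [|a]; first by rewrite inE ms orbT.
  by rewrite inE => /predU1P[->|]; [rewrite cm eqxx|exact: mmax].
- exists c => [|a]; first by rewrite inE eqxx.
  rewrite inE => /predU1P[->|]; first by rewrite eqxx.
  have [->//|am ads _] := eqVneq a m; exact: ltT (mmax _ ads am) mc.
Qed.

(** Take an ultrafilter containing an initial segment as short as possible, or F
itself if initial segments belong to none. By minimality no such ultrafilter
contains the initial segment below a point of the chosen one. *)
Lemma ulam_minimal (K : Type) (lt : K -> K -> Prop) (F : set_system K) :
  well_founded lt -> ulam_ultrafilter F ->
  exists2 F' : set_system K, ulam_ultrafilter F' &
    F' [set b | forall H, ulam_ultrafilter H -> ~ H [set c | lt c b]].
Proof.
move=> wf uF; pose big b := exists2 H, ulam_ultrafilter H & H [set c | lt c b].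
have [[b bigb]|nbig] := pselect (exists b, big b); last first.
  exists F => //; have [UF _ _] := uF; apply: filterS filterT => b _ H uH Hb.
  by apply: nbig; exists b, H.
elim/(well_founded_ind wf): b bigb => b IHb [H uH Hb].
have [[c cb bigc]|nc] := pselect (exists2 c, lt c b & big c); first exact: IHb bigc.
exists H => //; have [UH _ _] := uH; apply: filterS Hb => c cb H' uH' H'c.
by apply: nc; exists c => //; exists H'.
Qed.

(** * Compactness through closed families *)

Lemma compact_fip (T : topologicalType) (I : eqType) (D : set I)
    (C : I -> set T) (O : set T) :
  compact [set: T] -> (forall i, D i -> closed (C i)) -> open O ->
  (forall x, (forall i, D i -> C i x) -> O x) ->
  exists2 s : seq I, (forall i, i \in s -> D i) &
    forall x, (forall i, i \in s -> C i x) -> O x.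
Proof.
move=> cT clC opO CO; apply: contrapT => nos.
pose E (s : seq I) := [set x | (forall i, i \in s -> C i x) /\ ~ O x].
pose F : set_system T :=
  [set A | exists2 s : seq I, (forall i, i \in s -> D i) & E s `<=` A].
have PF : ProperFilter F.
  split.
    move=> [s sD Es0]; apply: nos; exists s => // x xC; apply: contrapT => nOx.
    exact: Es0 x (conj xC nOx).
  split; first by exists [::].
    move=> A B [s sD EA] [t tD EB]; exists (s ++ t) => [i|x [xC nOx]].
      by rewrite mem_cat => /orP[/sD|/tD].
    by split; [apply: EA|apply: EB]; split=> // i ?; apply: xC;
      rewrite mem_cat; apply/orP; [left|right].
  by move=> A B AB [s sD EA]; exists s => // x /EA /AB.
have [x [_ xF]] : [set: T] `&` cluster F !=set0 by apply: cT; exists [::].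
have : O x.
  apply: CO => i Di; apply: clC => // B Bx; apply: xF => //.
  exists [:: i] => [j|y [yC _]]; first by rewrite inE => /eqP->.
  by apply: yC; rewrite inE.
move=> Ox; have [] : E [::] `&` O !=set0.
  by apply: xF; [exists [::]|exact: open_nbhs_nbhs].
by move=> y [[_ ny] /ny].
Qed.

(** * Neighbourhoods of 1 and towers *)

Section GroupTopology.
Variables (G : groupType) (tau : topology_on G).
Hypothesis gtau : group_topology tau.
Local Notation T := (topologized tau).
Local Notation N1 := (nbhs (1%g : T)).
Local Open Scope group_scope.

Lemma mul_nbhs (x y : G) (A : set G) : nbhs (x * y : T) A ->
  exists B C : set G, [/\ nbhs (x : T) B, nbhs (y : T) C &
    forall b c, B b -> C c -> A (b * c)].
Proof.
have [mulc _ _] := gtau; move=> /(mulc (x, y))[[B C] /= [Bx Cy] BC].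
by exists B, C; split=> // b c Bb Cc; apply: (BC (b, c)).
Qed.

Lemma inv_nbhs (x : G) (A : set G) : nbhs (x^-1 : T) A ->
  nbhs (x : T) [set y : G | A y^-1].
Proof. by have [_ invc _] := gtau; move=> /(invc x). Qed.

Lemma mull_nbhs (g x : G) (A : set G) : nbhs (g * x : T) A ->
  nbhs (x : T) [set y : G | A (g * y)].
Proof.
move=> /mul_nbhs[B [C [Bg Cx BC]]]; apply: filterS Cx => c Cc.
exact: BC (nbhs_singleton Bg) Cc.
Qed.

Lemma mulr_nbhs (g x : G) (A : set G) : nbhs (x * g : T) A ->
  nbhs (x : T) [set y : G | A (y * g)].
Proof.
move=> /mul_nbhs[B [C [Bg Cx BC]]]; apply: filterS Bg => c Cc.
exact: BC Cc (nbhs_singleton Cx).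
Qed.

Lemma nbhs_translate (g : G) (A : set G) :
  nbhs (g : T) A <-> N1 [set y : G | A (g * y)].
Proof.
split=> [gA|/= hA]; first by apply: mull_nbhs; rewrite mulg1.
have : nbhs (g^-1 * g : T) [set y | A (g * y)] by rewrite mulVg.
by move=> /mull_nbhs; apply: filterS => y /=; rewrite mulVKg.
Qed.

Lemma open_translate (g : G) (O : set G) : open (O : set T) ->
  open ([set x : G | O (g * x)] : set T).
Proof.
by rewrite !openE => opO x /= /opO gx; exact: mull_nbhs.
Qed.

(** The conjugation is what continuity of the product at (x, g) needs, since
x b g c = (x g) (g^-1 b g c). *)
Lemma conj_mul_nbhs (g : G) (A : set G) : N1 A -> exists2 W : set G, N1 W &
  forall b c, W b -> W c -> A (g^-1 * b * g * c).
Proof.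
move=> A1; have : nbhs (g^-1 * 1 * g * 1 : T) A by rewrite !mulg1 mulVg.
move=> /mul_nbhs[B [C [/mulr_nbhs /mull_nbhs gB C1 BC]]].
exists (C `&` [set b | B (g^-1 * b * g)]); first exact: filterI.
by move=> b c [_ Bb] [Cc _]; apply: BC.
Qed.

Lemma conj_inv_nbhs (g : G) (A : set G) : N1 A ->
  N1 [set b : G | A (g * b^-1 * g^-1)].
Proof.
move=> N1A; apply: (@inv_nbhs 1 [set b : G | A (g * b * g^-1)]).
apply: (@mull_nbhs g _ [set b : G | A (b * g^-1)]).
by apply: mulr_nbhs; rewrite invg1 mulg1 mulgV.
Qed.

Lemma mul_nbhs1 (A : set G) : N1 A -> exists2 W : set G, N1 W &
  forall b c, W b -> W c -> A (b * c).
Proof.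
move=> /(conj_mul_nbhs 1)[W W1 WA]; exists W => // b c Wb Wc.
by have := WA b c Wb Wc; rewrite invg1 mul1g mulg1.
Qed.

Lemma inv_nbhs1 (A : set G) : N1 A -> N1 [set b : G | A b^-1].
Proof.
by move=> /(conj_inv_nbhs 1); apply: filterS => b /=; rewrite invg1 mul1g mulg1.
Qed.

(** Closed neighbourhoods are obtained from the fact that closure E is contained
in the product E E for symmetric E. *)
Lemma closed_nbhs_div (A : set G) : N1 A ->
  exists W : set G, [/\ N1 W, closed (W : set T) &
    forall x y z, W x -> W y -> W z -> A (x * y^-1 * z)].
Proof.
move=> /mul_nbhs1[B B1 BA]; have [C C1 CB] := mul_nbhs1 B1.
pose Q := C `&` B `&` [set b | C b^-1].
have /mul_nbhs1[D D1 DQ] : N1 Q by do ?apply: filterI => //; exact: inv_nbhs1.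
pose E : set G := D `&` [set d | D d^-1].
have E1 : N1 E by apply: filterI => //; exact: inv_nbhs1.
have clE x : closure (E : set T) x -> Q x.
  move=> /(_ [set y : G | E (x^-1 * y)])[|y [[Dy _] [_ Exy]]].
    by apply: mull_nbhs; rewrite mulVg.
  by rewrite -(mulVKg y x); apply: DQ => //; move: Exy; rewrite /= invgM invgK.
exists (closure (E : set T)); split.
- by apply: filterS E1; exact: (@subset_closure T E).
- exact: closed_closure.
by move=> x y z /clE[[Cx _] _] /clE[_ Cy] /clE[[_ Bz] _]; apply: BA => //; exact: CB.
Qed.

(** The combination x y^-1 z packages products and inverses in a single
condition, since some of the arguments can be taken to be 1; it turns the
intersection of the V n into a subgroup. *)
Definition tower (V : nat -> set G) : Prop := forall n,
  [/\ N1 (V n), closed (V n : set T) &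
      forall x y z, V n.+1 x -> V n.+1 y -> V n.+1 z -> V n (x * y^-1 * z)].

Lemma tower_exists (A : set G) : N1 A -> exists2 V, tower V & V 0%N `<=` A.
Proof.
have /choice[h hP] : forall B : set G, exists W : set G, N1 B ->
    [/\ N1 W, closed (W : set T) &
      forall x y z, W x -> W y -> W z -> B (x * y^-1 * z)].
  move=> B; have [B1|nB1] := pselect (N1 B); last by exists setT.
  by have [W WP] := closed_nbhs_div B1; exists W.
move=> A1; pose V n := iter n.+1 h A.
have V1 n : N1 (V n) by elim: n => [|n IHn]; [have [] := hP A A1|have [] := hP _ IHn].
exists V.
  move=> n; have [_ _ Vn] := hP _ (V1 n).
  by case: n Vn => [|n] Vn; split=> //; [have [] := hP _ A1|have [] := hP _ (V1 n)].
have [h1 _ hA] := hP A A1; move=> x hx; have := hA x 1 1 hx.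
by rewrite invg1 !mulg1; apply; exact: nbhs_singleton h1.
Qed.

Lemma tower_decr (V : nat -> set G) (n m : nat) (x : G) :
  tower V -> (n <= m)%N -> V m x -> V n x.
Proof.
move=> tV /subnK <-; elim: (m - n)%N => [//|k IHk].
rewrite addSn => Vx; apply: IHk; have [_ _ VV] := tV (k + n)%N.
have V1 : V (k + n).+1 1 by have [h _ _] := tV (k + n).+1; exact: nbhs_singleton h.
by have := VV x 1 1 Vx V1 V1; rewrite invg1 !mulg1.
Qed.

Definition core (V : nat -> set G) : set G := \bigcap_n V n.

Lemma core1 (V : nat -> set G) : tower V -> core V 1.
Proof. by move=> tV n _; have [h _ _] := tV n; exact: nbhs_singleton h. Qed.

Lemma coreM (V : nat -> set G) (x y : G) :
  tower V -> core V x -> core V y -> core V (x * y).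
Proof.
move=> tV Vx Vy n _; have [_ _ VV] := tV n.
by rewrite -(mulg1 x) -{1}invg1; apply: VV; [exact: Vx|exact: core1|exact: Vy].
Qed.

Lemma coreV (V : nat -> set G) (x : G) : tower V -> core V x -> core V x^-1.
Proof.
move=> tV Vx n _; have [_ _ VV] := tV n.
by rewrite -(mul1g x^-1) -(mulg1 (1 * _)); apply: VV; [exact: core1|exact: Vx|exact: core1].
Qed.

Lemma tower_mul_core (V : nat -> set G) (n : nat) (x y : G) :
  tower V -> V n.+1 x -> core V y -> V n (x * y).
Proof.
move=> tV Vx Vy; have [_ _ VV] := tV n.
by rewrite -(mulg1 x) -{1}invg1; apply: VV => //; [exact: core1|exact: Vy].
Qed.

(** Here l = h ((x l h')^-1 (x h))^-1 h'^-1: the inner difference costs one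
level of the tower and the outer product another one. *)
Lemma tower_diff (V : nat -> set G) (n : nat) (x h l h' : G) : tower V ->
  core V h -> core V h' -> V n.+2 (x * h) -> V n.+2 (x * (l * h')) -> V n l.
Proof.
move=> tV Vh Vh' Vxh Vxlh'.
have -> : l = h * (1 * (x * (l * h'))^-1 * (x * h))^-1 * h'^-1.
  by rewrite mul1g !invgM !invgK !mulgA mulgV mul1g mulVg mul1g mulgK.
have [_ _ V0] := tV n; have [_ _ V1] := tV n.+1.
apply: V0; [exact: Vh| |exact: coreV].
by apply: V1 => //; exact: core1.
Qed.

Lemma closed_core (V : nat -> set G) : tower V -> closed (core V : set T).
Proof. by move=> tV; apply: closed_bigI => n _; have [] := tV n. Qed.

Hypothesis ctau : compact [set: T].

Lemma finite_translates (O : set G) : N1 O -> exists s : seq G,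
  forall x, exists2 g, g \in s & O (g^-1 * x).
Proof.
move=> O1; pose C (g : G) : set G := ~` [set x | ((O : set T)^°) (g^-1 * x)].
have [] := @compact_fip T G [set: G] C set0 ctau; first 1 last.
- exact: open0.
- by move=> x /(_ x Logic.I); apply; rewrite /= mulVg; exact: nbhs_singleton (nbhs_interior O1).
- move=> s _ sC; exists s => x; apply: contrapT => ns; apply: (sC x) => g gs /= Ox.
  by apply: ns; exists g => //; exact: nbhs_singleton Ox.
by move=> g _; apply: open_closedC; apply: open_translate; exact: open_interior.
Qed.

(** If the cores indexed by I intersect trivially, then by compactness the
finite intersections of the neighbourhoods V c m, with c in I, form a local
base at 1. Each of them covers G by finitely many translates, and these
translates form a base. A triple (s, m, k) encodes the k-th translate chosen
for the intersection of the V c m, c in s; one level m is enough for all of s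
because towers decrease. *)
Lemma basis_of_towers (X : Type) (J : choiceType) (I : set J)
    (V : J -> nat -> set G) : (forall c, tower (V c)) ->
  (forall x, (forall c, I c -> core (V c) x) -> x = 1) ->
  (forall B : set (set T), basis B ->
     exists2 j : X -> set T, injective j & forall t, B (j t)) ->
  exists2 r : X -> seq J * nat * nat, injective r &
    forall t c, c \in (r t).1.1 -> I c.
Proof.
move=> tV V_sep leB.
pose O (i : seq J * nat) : set G :=
  ([set x : G | forall c, c \in i.1 -> V c i.2 x] : set T)^°.
have O1 i : N1 (O i).
  apply: nbhs_interior; case: i => s m /=; elim: s => [|c s IHs].
    by apply: filterS filterT.
  have [Vc _ _] := tV c m; apply: filterS (filterI Vc IHs) => x [Vx sx] d.
  by rewrite inE => /predU1P[->//|]; exact: sx.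
have /choice[cov covP] i := finite_translates (O1 i).
pose E (i : seq J * nat * nat) : set G := [set x | O i.1 ((nth 1 (cov i.1) i.2)^-1 * x)].
have [|j j_inj jB] := leB [set Q | exists2 i, (forall c, c \in i.1.1 -> I c) & Q = E i].
  split=> [_ [i _ ->]|x A /nbhs_translate].
    by apply: open_translate; exact: open_interior.
  move=> /closed_nbhs_div[W [W1 _ WA]].
  have [] := @compact_fip T (J * nat)%type [set i | I i.1] (fun i => V i.1 i.2)
      ((W : set T)^°) ctau.
  - by move=> i _; have [] := tV i.1 i.2.
  - exact: open_interior.
  - move=> y Vy; have -> : y = 1.
      by apply: V_sep => c Ic n _; exact: Vy (c, n) Ic.
    exact: nbhs_singleton (nbhs_interior W1).
  move=> s sI sW; pose i := (map fst s, (\max_(c <- s) c.2)%N).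
  have OW : O i `<=` W.
    move=> y /interior_subset /= Vy; apply: (@interior_subset T W); apply: sW => c cs.
    apply: tower_decr (tV _) _ (Vy _ (map_f _ cs)).
    exact: leq_bigmax_seq.
  have [g gcov Ogx] := covP i x.
  have EE : E (i, index g (cov i)) = [set y | O i (g^-1 * y)] by rewrite /E /= nth_index.
  exists (E (i, index g (cov i))) => /=.
    split; last by rewrite EE.
    by exists (i, index g (cov i)) => // c /mapP[d /sI Id ->].
  rewrite EE => y /= Ogy.
  have := WA 1 _ _ (nbhs_singleton W1) (OW _ Ogx) (OW _ Ogy).
  by rewrite /= mul1g invgM invgK !mulgA mulgV mul1g mulgV mul1g.
have /choice[r rP] : forall t, exists i : seq J * nat * nat,
    (forall c, c \in i.1.1 -> I c) /\ j t = E i.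
  by move=> t; have [i] := jB t; exists i.
exists r => [t u rtu|t]; last by have [] := rP t.
by apply: j_inj; have [_ ->] := rP t; have [_ ->] := rP u; rewrite rtu.
Qed.

(** * Independent towers *)

Section IndependentTowers.
Variables (K : choiceType) (lt : rel K).
Hypotheses (lt_wf : well_founded lt) (lt_trans : transitive lt).
Hypothesis lt_total : forall a b, [\/ lt a b, a = b | lt b a].

Definition small (b : K) : Prop :=
  forall H, ulam_ultrafilter H -> ~ H [set c | lt c b].

Definition independent (V : K -> nat -> set G) : Prop :=
  forall b, small b ->
    exists2 l, (forall c, lt c b -> core (V c) l) & ~ V b 0%N l.

(** For small b the cores chosen so far have a common point l other than 1, since
otherwise K would inject into sequences below b; any tower starting outside l
can then be taken for V b. *)
Lemma independent_towers (F : set_system K) : ulam_ultrafilter F ->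
  (forall B : set (set T), basis B ->
     exists2 j : K -> set T, injective j & forall t, B (j t)) ->
  exists2 V : K -> nat -> set G, (forall b, tower (V b)) & independent V.
Proof.
move=> uF leB; have [V0 tV0 _] := tower_exists (@filterT _ N1 _).
pose X := {V | tower V}.
have [|b f|f fP] := @well_founded_choice K X (exist _ V0 tV0) lt
  (fun b f v => small b ->
    exists2 l, (forall c, lt c b -> core (proj1_sig (f c)) l) &
      ~ proj1_sig v 0%N l) lt_wf.
- move=> b f g x fg + sb => /(_ sb)[l lf xl]; exists l => // c cb.
  by rewrite -fg //; exact: lf.
- have [sb|nsb] := pselect (small b); last by exists (exist _ V0 tV0) => /nsb.
  have [l lf l1] : exists2 l, (forall c, lt c b -> core (proj1_sig (f c)) l) & l <> 1.
    apply: contrapT => nl.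
    have [|||r r_inj rI] := @basis_of_towers K K [set c | lt c b] (fun c => proj1_sig (f c)).
    + by move=> c; exact: proj2_sig.
    + by move=> x xf; apply: contrapT => x1; apply: nl; exists x.
    + exact: leB.
    (* The default value b of nth lies outside the initial segment; it is
       harmless because a free ultrafilter does not contain the set {b}. *)
    have [|i uH] := @ulam_joint_injective K K (fun i t => nth b (r t).1.1 i)
        (fun i t => match i with
                    | 0 => size (r t).1.1 | 1 => (r t).1.2 | _ => (r t).2 end) F _ uF.
      move=> t u Ef Eg; apply: r_inj.
      move: (Eg 0%N) (Eg 1%N) (Eg 2%N) Ef => /=.
      case: (r t) (r u) => [[s m] k] [[s' m'] k'] /= Es -> -> En.
      by rewrite (eq_from_nth Es (fun i _ => En i)).
    apply: (sb _ uH); have [UH _ nH] := uH; have [UF _ _] := uF.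
    have [//|Hb] := @in_ultra_setVsetC _ _ [set c | lt c b] UH.
    exfalso; apply: (nH b); apply: filterS Hb => t /=.
    have [it|it] := ltnP i (size (r t).1.1); last by rewrite nth_default.
    by case; apply: rI (mem_nth _ it).
  have N1l : N1 (~` [set l]).
    have [_ _ hT] := gtau; apply: open_nbhs_nbhs; split; last by move/esym.
    apply: closed_openC; apply: accessible_closed_set1.
    exact: hausdorff_accessible.
  have [V tV Vl] := tower_exists N1l.
  by exists (exist _ V tV) => _; exists l => // /Vl; apply.
exists (fun b => proj1_sig (f b)) => [b|b /fP//]; exact: proj2_sig.
Qed.

(** Indices are treated in increasing order. At a new largest index m, the
current point x is multiplied, if its coset by core (V m) meets V m 2, by an
element l that lies in all earlier cores but not in V m 0. The earlier
conditions survive because they concern cosets of the earlier cores; this is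
why the conclusion speaks of x * h and not only of x. *)
Lemma avoid_finite (V : K -> nat -> set G) (A : set K) (D : seq K) :
  (forall b, tower (V b)) -> independent V ->
  (forall c, c \in D -> small c) -> (forall a c, A a -> c \in D -> lt a c) ->
  exists2 x, (forall a, A a -> core (V a) x) &
    forall c, c \in D -> forall h, core (V c) h -> ~ V c 2%N (x * h).
Proof.
move=> tV iV; have [n] := ubnP (size D); elim: n D => // n IHn [|d D] szD sD AD.
  by exists 1 => // a _; exact: core1.
have [m mD mmax] := seq_max d D lt_trans lt_total.
have [|c|a c Aa|x xA xD] := IHn [seq c <- d :: D | c != m].
- rewrite ltnS in szD; apply: leq_trans szD; rewrite size_filter.
  rewrite -(count_predC (fun c => c != m) (d :: D)) -addn1 leq_add2l -has_count.
  by apply/hasP; exists m => //=; rewrite negbK.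
- by rewrite mem_filter => /andP[_ /sD].
- by rewrite mem_filter => /andP[_ /(AD _ _ Aa)].
have [nxm|xm] := pselect (forall h, core (V m) h -> ~ V m 2%N (x * h)).
  exists x => // c cD; have [->//|cm] := eqVneq c m.
  by apply: xD; rewrite mem_filter cm.
have [h Vh Vxh] : exists2 h, core (V m) h & V m 2%N (x * h).
  by apply: contrapT => nh; apply: xm => h Vh Vxh; apply: nh; exists h.
have [l lc lm] := iV m (sD _ mD).
exists (x * l) => [a Aa|c cD h' Vh'].
  by apply: coreM => //; [exact: xA|apply: lc; exact: AD].
rewrite -mulgA; have [cm|cm] := eqVneq c m.
  by rewrite cm in Vh' *; move=> Vxlh'; apply: lm; exact: (tower_diff (tV m) Vh Vh' Vxh Vxlh').
apply: xD; first by rewrite mem_filter cm.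
by apply: coreM => //; apply: lc; exact: mmax.
Qed.

(** The levels 4, 3, 2 leave room for multiplying by an element of the core and
for passing to an interior. *)
Lemma limit_not_nbhs (p : set_system K) (V : K -> nat -> set G) :
  ulam_ultrafilter p -> p small ->
  (forall b, tower (V b)) -> independent V ->
  ~ N1 [set x | p [set a | V a 4%N x]].
Proof.
move=> up psmall tV iV /(@nbhs_interior T) W1; have [Up _ np] := up.
set U := interior _ in W1.
have p_above b : small b -> p [set c | lt b c].
  move=> sb; have [|pb] := @in_ultra_setVsetC _ p [set c | lt c b] Up.
    by move/(sb _ up).
  have [/np//|pb'] := @in_ultra_setVsetC _ p [set b] Up.
  by apply: filterS (filterI pb pb') => c [ncb cb]; case: (lt_total b c) => // /esym.
(* UP is the open set U P. It contains the intersection P of the cores of small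
   indices, hence also a finite intersection of them, indexed by s. *)
pose P : set G := [set x | forall a, small a -> core (V a) x].
pose UP : set G := [set x | exists2 y, P y & U (x * y^-1)].
have UP3 x : UP x -> p [set a | V a 3%N x].
  move=> [y Py /interior_subset Wxy]; apply: filterS (filterI Wxy psmall) => a [Vxy sa].
  by rewrite /= -(mulgVK y x); apply: tower_mul_core (tV a) Vxy (Py _ sa).
have [||x Px|s sS sUP] := @compact_fip T K small (fun a => core (V a)) UP ctau.
- by move=> a _; exact: closed_core.
- rewrite openE => x [y Py Uxy]; apply: (@filterS _ _ _ [set z : G | U (z * y^-1)]).
    by move=> z Uz; exists y.
  by apply: mulr_nbhs; apply: open_nbhs_nbhs; split=> //; exact: open_interior.
- by exists x => //; rewrite mulgV; exact: nbhs_singleton W1.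
pose D : set K := [set c | small c /\ forall a, a \in s -> lt a c].
have pD : p D.
  apply: filterI => //; elim: s sS {sUP D} => [|a s IHs] sS.
    by apply: filterS filterT.
  have /p_above pa := sS a (mem_head _ _).
  have ps := IHs (fun c cs => sS c (mem_behead (s := a :: s) cs)).
  by apply: filterS (filterI pa ps) => c [ac sc] d; rewrite inE => /predU1P[->//|/sc].
(* Every point of the finite intersection lies in V c 3 for some c in D, so by
   compactness finitely many such c are enough, against avoid_finite. *)
have [||x xD|t tD tP] := @compact_fip T K D (fun c => ~` ((V c 2%N : set T)^°))
    (~` [set x | forall a, a \in s -> core (V a) x]) ctau.
- by move=> c _; apply: open_closedC; exact: open_interior.
- apply: closed_openC.
  have -> : [set x : T | forall a, a \in s -> core (V a) x] =
      \bigcap_(a in [set a | a \in s]) core (V a) by [].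
  by apply: closed_bigI => a _; exact: closed_core.
- move=> xs; have /UP3 p3 := sUP x xs; have [c [Vx Dc]] := filter_ex (filterI p3 pD).
  apply: (xD c Dc); apply/nbhs_translate.
  have [V1 _ _] := tV c 3%N; have [_ _ V2] := tV c 2%N.
  apply: filterS (V1) => y Vy.
  by rewrite /= -(mulg1 x) -invg1; apply: V2 => //; exact: nbhs_singleton V1.
have [c|a c|x xs xt] := @avoid_finite V [set a | a \in s] t tV iV.
- by move/tD => [].
- by move=> sa /tD[_]; apply.
apply: (tP x) => // c ct /interior_subset; rewrite -(mulg1 x).
by apply: xt ct _ _; exact: core1.
Qed.

End IndependentTowers.

End GroupTopology.

(** * The ultrafilter topology *)

Lemma nbhs_topology (G : choiceType) (N : G -> set_system G) :
  (forall x, ProperFilter (N x)) -> (forall x A, N x A -> A x) ->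
  (forall x A, N x A -> N x [set y | N y A]) ->
  exists sigma : topology_on G, forall x, nbhs (x : topologized sigma) = N x.
Proof.
move=> NF N1 NN; pose T0 : nbhsType := HB.pack G (hasNbhs.Build G N).
pose T : topologicalType := HB.pack T0 (Nbhs_isNbhsTopological.Build T0 NF N1 NN).
by exists (Topological.class T).
Qed.

Section UltraTopology.
Variables (G : groupType) (tau : topology_on G) (K : Type) (p : set_system K).
Hypotheses (gtau : group_topology tau) (Up : UltraFilter p).
Local Notation T := (topologized tau).
Local Notation N1 := (nbhs (1%g : T)).
Local Open Scope group_scope.

Definition ultra_nbhs (x : G) : set_system G :=
  [set A | exists2 V : K -> set G, (forall a, N1 (V a)) &
     forall y, p [set a | V a y] -> A (x * y)].

Lemma ultra_nbhs_proper x : ProperFilter (ultra_nbhs x).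
Proof.
split.
  move=> [V V1 VA]; apply: (VA 1); apply: filterS filterT => a _.
  exact: nbhs_singleton (V1 a).
split; first by exists (fun=> setT) => // a; exact: filterT.
  move=> A B [V V1 VA] [W W1 WB]; exists (fun a => V a `&` W a) => [a|y Py].
    exact: filterI.
  by split; [apply: VA|apply: WB]; apply: filterS Py => a [].
by move=> A B AB [V V1 VA]; exists V => // y /VA /AB.
Qed.

Lemma ultra_nbhs_singleton x A : ultra_nbhs x A -> A x.
Proof.
move=> [V V1 VA]; rewrite -(mulg1 x); apply: VA; apply: filterS filterT => a _.
exact: nbhs_singleton (V1 a).
Qed.

Lemma ultra_nbhs_nbhs x A : ultra_nbhs x A -> ultra_nbhs x [set y | ultra_nbhs y A].
Proof.
move=> [V V1 VA]; have /choice[W WP] a : exists W : set G, N1 W /\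
    forall b c, W b -> W c -> V a (b * c).
  by have [W W1 WV] := mul_nbhs1 gtau (V1 a); exists W.
exists W => [a|y Py]; first by have [] := WP a.
exists W => [a|z Pz]; first by have [] := WP a.
rewrite -mulgA; apply: VA; apply: filterS (filterI Py Pz) => a [Wy Wz].
by have [_] := WP a; apply.
Qed.

Lemma nbhs_ultra_nbhs x A : nbhs (x : T) A -> ultra_nbhs x A.
Proof.
move=> /(nbhs_translate gtau) xA; exists (fun=> [set y | A (x * y)]) => // y py.
by have [a] := filter_ex py.
Qed.

Lemma ultra_group_topology (sigma : topology_on G) :
  (forall x, nbhs (x : topologized sigma) = ultra_nbhs x) -> group_topology sigma.
Proof.
move=> sE; split.
- move=> [x y] A xyA; have [V V1 VA] : ultra_nbhs (x * y) A by rewrite -sE.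
  have /choice[W WP] a : exists W : set G, N1 W /\
      forall b c, W b -> W c -> V a (y^-1 * b * y * c).
    by have [W W1 WV] := conj_mul_nbhs gtau y (V1 a); exists W.
  pose Q : set G := [set u | p [set a | W a u]].
  exists ([set z | Q (x^-1 * z)], [set z | Q (y^-1 * z)]) => /=.
    by rewrite /= !sE; split; exists W => [a|u Qu]; rewrite /= ?mulKg //; have [] := WP a.
  move=> [b c] /= [Qb Qc]; have -> : b * c = x * y * (y^-1 * (x^-1 * b) * y * (y^-1 * c)).
    by rewrite !mulgA !mulgK mulgV mul1g.
  apply: VA; apply: filterS (filterI Qb Qc) => a [Wb Wc].
  by have [_] := WP a; apply.
- move=> x A xA; have [V V1 VA] : ultra_nbhs x^-1 A by rewrite -sE.
  suff : ultra_nbhs x [set y | A y^-1] by rewrite -sE.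
  exists (fun a => [set b | V a (x * b^-1 * x^-1)]) => [a|y Py].
    exact: conj_inv_nbhs.
  rewrite /=; have -> : (x * y)^-1 = x^-1 * (x * y^-1 * x^-1) by rewrite invgM !mulgA mulVg mul1g.
  exact: VA.
move=> x y xy; have [_ _ hT] := gtau; apply: hT => A B xA yB.
by apply: xy; rewrite sE; exact: nbhs_ultra_nbhs.
Qed.

(** A cover without finite subcover yields a sequence x that eventually leaves
each of its members. Let l be a tau-cluster point of x and V a family of
neighbourhoods such that l W_V lies in a member f i. One index a decides as p
does whether each l^-1 x n belongs to W_V; since x is frequently in l (V a), it
is frequently in f i. *)
Lemma ultra_countably_compact (sigma : topology_on G) :
  (forall x, nbhs (x : topologized sigma) = ultra_nbhs x) ->
  omega1_complete p -> compact [set: T] ->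
  countably_compact [set: topologized sigma].
Proof.
move=> sE cp cT I D f Dc fo covD; apply: contrapT => nofin.
have /countable_injP[e e_inj] := Dc.
pose tail n := [set x : G | forall i, D i -> (e i <= n)%N -> ~ f i x].
have /choice[x xP] n : exists x, tail n x.
  apply: contrapT => nx; apply: nofin.
  pose Dn := D `&` [set i | (e i <= n)%N].
  have finD : finite_set Dn.
    have /eq_finite_set <- : ([set e i | i in Dn] #= Dn)%card.
      by apply: inj_card_eq => i j /set_mem[Di _] /set_mem[Dj _]; apply: e_inj; exact/mem_set.
    by apply: (sub_finite_set _ (finite_II n.+1)) => _ [i [_ ein] <-].
  exists (fset_set Dn) => [i|y _]; first by rewrite in_fset_set // !inE => -[].
  apply: contrapT => ny; apply: nx; exists y => i Di ein fiy; apply: ny.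
  by exists i => //=; rewrite in_fset_set // inE.
pose F : set_system T := [set A | exists n, forall m, (n <= m)%N -> A (x m)].
have PF : ProperFilter F.
  split; first by move=> [n /(_ n (leqnn n))].
  split; first by exists 0%N.
    move=> A B [n nA] [m mB]; exists (maxn n m) => k; rewrite geq_max => /andP[nk mk].
    by split; [exact: nA|exact: mB].
  by move=> A B AB [n nA]; exists n => m /nA /AB.
have [l [_ lF]] : [set: T] `&` cluster F !=set0 by apply: cT => //; exists 0%N.
have [i Di fil] := covD l Logic.I.
have [V V1 VA] : ultra_nbhs l (f i).
  by rewrite -sE; apply: open_nbhs_nbhs; split=> //; exact: fo.
pose y n := l^-1 * x n.
have dec n : p [set a | V a (y n) <-> p [set b | V b (y n)]].
  exact: (@ultra_decide _ p [set a | V a (y n)]).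
have [a ya] := filter_ex (cp _ dec).
have [_ [[n ein <-] /= Va]] : (x @` [set n | (e i <= n)%N]) `&`
    [set z : G | V a (l^-1 * z)] !=set0.
  apply: lF; first by exists (e i) => m eim; exists m.
  by apply: (mull_nbhs gtau); rewrite mulVg.
have /VA : p [set b | V b (y n)] by apply/(ya n Logic.I).
by rewrite mulVKg; exact: xP Di ein.
Qed.

End UltraTopology.

Theorem corollary3p17 (G : groupType) (tau : topology_on G)
    (U : Type) (kappa : set U) :
  group_topology tau ->
  compact [set: topologized tau] ->
  is_weight (topologized tau) kappa ->
  ulam_measurable kappa ->
  exists sigma : topology_on G,
    [/\ group_topology sigma,
        countably_compact [set: topologized sigma]
      & strictly_finer sigma tau].
Proof.
move=> gtau ctau [_ leB] [F [UF cF nF]].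
pose K := {classic kappa}.
have uF : @ulam_ultrafilter K F.
  split=> // x Fx; apply: (nF x); have [PF _] := UF.
  apply: (@max_filter _ _ (principal_filter_ultra x) F PF).
  by move=> A /principal_filterP Ax; apply: filterS Fx => _ ->.
have leK B : basis B -> exists2 j : K -> set (topologized tau),
    injective j & forall t, B (j t).
  move=> /leB /card_leP[f]; exists (fun t : K => val (f t)) => [s t /val_inj|t].
    by move/inj; apply; rewrite inE.
  exact: set_valP.
have [lt [lt_wf lt_trans lt_total]] := strict_well_order K.
have [p up psmall] := ulam_minimal lt_wf uF; have [Up cp _] := up.
have [V tV iV] := independent_towers gtau ctau lt_wf uF leK.
have [sigma sE] := nbhs_topology (ultra_nbhs_proper tau Up)
  (ultra_nbhs_singleton Up) (ultra_nbhs_nbhs gtau Up).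
exists sigma; split.
- exact: ultra_group_topology sE.
- exact: ultra_countably_compact sE cp ctau.
split=> [O|sub].
  rewrite !openE => opO x /opO xO; have : ultra_nbhs tau p x O.
    exact: nbhs_ultra_nbhs.
  by rewrite -sE.
pose W : set G := [set x | p [set a | V a 4%N x]].
have W1 : nbhs (1%g : topologized sigma) W.
  rewrite sE; exists (fun a => V a 4%N) => [a|y]; first by have [] := tV a 4%N.
  by rewrite mul1g.
apply: (limit_not_nbhs gtau ctau lt_trans lt_total up psmall tV iV).
move: W1; rewrite nbhsE => -[Q [/sub opQ Q1] QW].
by rewrite nbhsE; exists Q.
Qed.
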